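(* Let $H$ be a graph on $m$ vertices with $e$ edges such that $e>m\sqrt{m-1}$. If $m\ge 6$, then $H$ is not $\binom{m}{2}$-anti-common.
   Context: All graphs are finite and simple. An $r$-edge-coloring of a graph is a function from its edge set to $\{1,\dots,r\}$ (not necessarily proper). A subgraph is rainbow if its edges have pairwise distinct colors. A copy of $H$ in $K_n$ is a (not necessarily induced) subgraph of $K_n$ isomorphic to $H$. Let $H$ be a graph with $m$ vertices and $e$ edges. $rb_r(H;n)$ denotes the maximum, over all $r$-edge-colorings of $K_n$, of the number of rainbow copies of $H$ in $K_n$. For $n\ge m$ put $rbC_r(H;n)=\dfrac{rb_r(H;n)}{\binom{n}{m}\frac{m!}{|\mathrm{Aut}(H)|}}$, and let $rbC_r(H)=\lim_{n\to\infty} rbC_r(H;n)$ (this limit exists). For an integer $r\ge m$, $H$ is called $r$-anti-common if $rbC_r(H)=\dfrac{\binom{r}{e}e!}{r^e}$. *)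

(* Defs.v *)
From HB Require Import structures.
From mathcomp Require Import all_boot all_order all_fingroup all_algebra.
From mathcomp Require Import all_classical all_reals all_analysis.
Import Order.TTheory GRing.Theory Num.Theory.
Import numFieldNormedType.Exports.

Set Implicit Arguments.
Unset Strict Implicit.
Unset Printing Implicit Defensive.

Local Open Scope ring_scope.

Record sgraph := SGraph {
  vertex :> finType;
  adj : rel vertex;
  adj_sym : symmetric adj;
  adj_irrefl : irreflexive adj }.

Definition edges (G : sgraph) : {set {set G}} :=
  [set [set p.1; p.2] | p : G * G & adj p.1 p.2]%SET.

Definition Aut_graph (G : sgraph) : {set {perm G}} :=
  [set s : {perm G} | [forall x, forall y, adj (s x) (s y) == adj x y]]%SET.

Definition Kedge (n : nat) : finType := {A : {set 'I_n} | #|A| == 2%N}.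

Definition edge_coloring (r n : nat) : finType := {ffun Kedge n -> 'I_r}.

(* A subgraph of K_n is a pair (vertex set, edge set). The vertex set is kept
   because H may have isolated vertices, in which case distinct copies of H may
   share the same edge set. *)
Definition is_copy (H : sgraph) (n : nat)
    (S : {set 'I_n} * {set Kedge n}) : bool :=
  [exists f : {ffun H -> 'I_n},
    [&& injectiveb f,
        S.1 == (f @: [set: H])%SET &
        [set val B | B in S.2]%SET == [set (f @: A)%SET | A : {set H} in edges H]%SET]].

Definition rainbow (r n : nat) (c : edge_coloring r n)
    (S : {set 'I_n} * {set Kedge n}) : bool :=
  [forall A in S.2, forall B in S.2, (c A == c B) ==> (A == B)].

Definition rb (r : nat) (H : sgraph) (n : nat) : nat :=
  \max_(c : edge_coloring r n)
    #|[set S : {set 'I_n} * {set Kedge n} | is_copy H S && rainbow c S]%SET|.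

(* For n < #|H| the denominator is 0, so this is 0 by convention; this does
   not affect the limit. *)
Definition rbC_n (R : realType) (r : nat) (H : sgraph) (n : nat) : R :=
  (rb r H n)%:R /
  ('C(n, #|{: H}|)%:R * ((#|{: H}|)`!%:R / #|Aut_graph H|%:R)).

Definition rbC (R : realType) (r : nat) (H : sgraph) : R :=
  limn (rbC_n R r H).

Definition anti_common (R : realType) (r : nat) (H : sgraph) : Prop :=
  (#|{: H}| <= r)%N /\
  rbC R r H = ('C(r, #|edges H|)%:R * (#|edges H|)`!%:R) / r%:R ^+ #|edges H|.

(* Main.v *)
Require Import Defs.
From mathcomp Require Import all_boot all_order all_fingroup all_algebra.
From mathcomp Require Import all_classical all_reals all_analysis.
From mathcomp Require Import lra.
Import Order.TTheory GRing.Theory Num.Theory.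
Import numFieldNormedType.Exports.
Local Open Scope ring_scope.

Set Implicit Arguments.
Unset Strict Implicit.
Unset Printing Implicit Defensive.

(** Write [r = 'C(m, 2)].  Uniformly random [r]-colourings make a copy of [H]
rainbow with probability [r ^_ e / r ^ e].  For dense [H] this is beaten by a
structured colouring: colour the [r] edges of the complete graph on [m] points
with [r] distinct colours and blow every point up to a class of [q] vertices.
A set of vertices meeting each class once spans a rainbow complete graph, so all
copies of [H] on such a set are rainbow at once.  There are [q ^ m] of these
sets among at most [(m * q) ^ m / m`!] sets of [m] vertices, hence a proportion
at least [m`! / m ^ m] of all copies is rainbow ([rb_blowup], [rbC_n_blowup]),
and this passes to the limit ([limn_ge_multiples]).

It remains to compare the two constants ([ffact_ratio_lt]).  On one side
[m`! / m ^ m >= exp (- (m - 1))] ([fact_ge_expR]).  On the other,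
[r ^_ e / r ^ e] is the product of the [1 - i / r] for [i < e], which is at most
[exp (- 'C(e, 2) / r)] ([ffact_le_expR]).  As
['C(e, 2) / r = (e ^ 2 - e) / (m * (m - 1))], the hypothesis
[e ^ 2 > m ^ 2 * (m - 1)] together with [e <= r] makes this exponent larger than
[m - 1 / 2], so the inequality between the constants is strict
([edge_bound_exponent]). *)

(** * Copies of a graph and their embeddings *)

Lemma adj_edges (H : sgraph) (x y : H) : adj x y = ([set x; y]%SET \in edges H).
Proof.
apply/idP/imsetP => [xy | [[u v] uv /= E]]; first by exists (x, y); rewrite ?inE.
rewrite inE /= in uv.
have nuv : u != v by apply: contraTneq uv => ->; rewrite adj_irrefl.
have card2 : #|[set x; y]%SET| == 2 by rewrite E cards2 nuv.
have := set21 x y; have := set22 x y; rewrite E !inE.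
move: card2; rewrite cards2; case: eqVneq => // nxy _.
by move=> /orP[] /eqP yE /orP[] /eqP xE; move: nxy; rewrite yE xE ?eqxx // adj_sym.
Qed.

Lemma card_edge (H : sgraph) (A : {set H}) : A \in edges H -> #|A| = 2.
Proof.
case/imsetP => -[x y]; rewrite inE /= => xy ->; rewrite cards2.
by case: eqVneq xy => // ->; rewrite adj_irrefl.
Qed.

Lemma card_edges (H : sgraph) : (#|edges H| <= 'C(#|{: H}|, 2))%N.
Proof.
rewrite -card_draws; apply/subset_leq_card/fintype.subsetP => A /card_edge A2.
by rewrite inE A2.
Qed.

Definition copy_of (H : sgraph) (n : nat) (f : {ffun H -> 'I_n}) :
    {set 'I_n} * {set Kedge n} :=
  (f @: [set: H],
   [set B : Kedge n | val B \in [set f @: A | A : {set H} in edges H]])%SET.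

Lemma copy_of_edges (H : sgraph) (n : nat) (f : {ffun H -> 'I_n}) :
  injective f ->
  [set val B | B in (copy_of f).2]%SET = [set (f @: A)%SET | A : {set H} in edges H]%SET.
Proof.
move=> inj_f; apply/setP => X; apply/imsetP/idP => [[B + ->] | fX].
  by rewrite inE.
have /imsetP[A /card_edge A2 XE] := fX.
have X2 : #|X| == 2 by rewrite XE card_imset // A2.
by exists (Sub X X2); rewrite ?inE ?SubK.
Qed.

Lemma copy_of_is_copy (H : sgraph) (n : nat) (f : {ffun H -> 'I_n}) :
  injective f -> is_copy H (copy_of f).
Proof.
move=> inj_f; apply/existsP; exists f.
by rewrite (introT (injectiveP f) inj_f) eqxx copy_of_edges /=.
Qed.

(** Two embeddings with the same image differ by the permutation that composes
one with the inverse of the other; it preserves adjacency because both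
embeddings produce the same edge set. *)
Lemma copy_of_Aut (H : sgraph) (n : nat) (f g : {ffun H -> 'I_n}) :
  injective f -> injective g -> copy_of f = copy_of g ->
  exists2 s : {perm H}, s \in Aut_graph H & g = [ffun v => f (s v)].
Proof.
move=> inj_f inj_g fg.
have im v : g v \in codom f.
  have : g v \in (copy_of f).1 by rewrite fg imset_f.
  by case/imsetP => u _ ->; apply: codom_f.
pose t v := iinv (im v); have ft v : f (t v) = g v by apply: f_iinv.
have inj_t : injective t by move=> u v uv; apply: inj_g; rewrite -!ft uv.
exists (perm inj_t); last by apply/ffunP => v; rewrite ffunE permE ft.
rewrite inE; apply/forallP => x; apply/forallP => y; rewrite !adj_edges !permE.
rewrite -(mem_imset _ _ (imset_inj inj_f)) -(mem_imset _ _ (imset_inj inj_g)).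
by rewrite -!copy_of_edges // fg !imsetU1 !imset_set1 !ft.
Qed.

(** Counting copies is reduced to counting embeddings, which are easier to
enumerate: each copy is the image of at most one embedding per automorphism. *)
Lemma card_embeddings_le (H : sgraph) (n : nat) (D : {set {ffun H -> 'I_n}})
    (P : {set {set 'I_n} * {set Kedge n}}) :
  (forall f, f \in D -> injective f) -> (forall f, f \in D -> copy_of f \in P) ->
  (#|D| <= #|P| * #|Aut_graph H|)%N.
Proof.
move=> injD DP; rewrite -sum1_card (partition_big (@copy_of H n) (mem P)) //=.
rewrite -sum_nat_const; apply: leq_sum => S _; rewrite sum1dep_card.
have [-> | [f]] := set_0Vmem [set f | (f \in D) && (copy_of f == S)]%SET.
  by rewrite cards0.
rewrite inE => /andP[fD /eqP fS].
apply: leq_trans (leq_imset_card (fun s : {perm H} => [ffun v => f (s v)]) _).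
apply/subset_leq_card/fintype.subsetP => g; rewrite inE => /andP[gD /eqP gS].
have [||| s sA ->] := @copy_of_Aut _ _ f g; rewrite ?fS ?gS //; try exact: injD.
exact: imset_f.
Qed.

(** * The blow-up colouring *)

(** The map [h] sends a vertex to its class and [k] colours the pairs of classes.
An edge inside a class has a singleton as its image under [h]; its colour is
whatever [k] assigns to singletons. *)
Definition blowup_coloring (H : sgraph) (r n : nat) (k : {set H} -> 'I_r)
    (h : 'I_n -> H) : edge_coloring r n :=
  [ffun B : Kedge n => k (h @: val B)%SET].

(** Composing [f] with [h] embeds [H] into the complete graph on the classes,
where [k] gives different pairs different colours. *)
Lemma transversal_rainbow (H : sgraph) (r n : nat) (k : {set H} -> 'I_r)
    (h : 'I_n -> H) (f : {ffun H -> 'I_n}) :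
  {in [set A : {set H} | #|A| == 2]%SET &, injective k} ->
  injective (h \o f) -> rainbow (blowup_coloring k h) (copy_of f).
Proof.
move=> inj_k inj_hf; apply/forall_inP => B + ; rewrite inE => /imsetP[A AH BE].
apply/forall_inP => B' + ; rewrite inE => /imsetP[A' A'H B'E].
apply/implyP; rewrite !ffunE BE B'E -!imset_comp => /eqP /inj_k kE.
apply/eqP/val_inj; rewrite [LHS]BE [RHS]B'E; suff -> : A = A' by [].
by apply: (imset_inj inj_hf); apply: kE; rewrite inE card_imset // card_edge.
Qed.

Lemma pair_coloring_exists (T : finType) (r : nat) :
  (0 < r)%N -> ('C(#|T|, 2) <= r)%N ->
  exists k : {set T} -> 'I_r, {in [set A : {set T} | #|A| == 2]%SET &, injective k}.
Proof.
move=> r_gt0 leCr; set E := [set A | _]%SET.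
have idx A : A \in E -> (index A (enum E) < r)%N.
  move=> AE; apply: leq_trans leCr; rewrite -card_draws cardE index_mem.
  by rewrite mem_enum.
exists (fun A => insubd (Ordinal r_gt0) (index A (enum E))) => A B AE BE.
move/(congr1 val); rewrite !val_insubd !idx //.
by apply: index_inj; rewrite ?mem_enum.
Qed.

Definition transversals (H : sgraph) (n : nat) (h : 'I_n -> H) :
    {set {ffun H -> 'I_n}} :=
  [set f : {ffun H -> 'I_n} | injectiveb (h \o f)]%SET.

(** With classes of size [q] indexed by the vertices of [H], a transversal
embedding amounts to a bijection from [H] to the classes and a choice of one of
the [q] vertices in each class. *)
Lemma card_transversals (H : sgraph) (q : nat) :
  ((#|{: H}|)`! * q ^ #|{: H}| <=
   #|transversals (fun x : 'I_#|{: H * 'I_q}| => (enum_val x).1)|)%N.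
Proof.
pose F (p : {perm H} * {ffun H -> 'I_q}) : {ffun H -> 'I_#|{: H * 'I_q}|} :=
  [ffun v => enum_rank (p.1 v, p.2 v)].
have inj_F : injective F.
  move=> [s g] [t k] /ffunP st.
  have sg v : (s v, g v) = (t v, k v).
    by move: (st v); rewrite !ffunE /= => /enum_rank_inj.
  by congr pair; [apply/permP | apply/ffunP] => v; case: (sg v).
have -> : ((#|{: H}|)`! * q ^ #|{: H}|)%N = #|[set F p | p in predT]%SET|.
  rewrite card_imset // card_prod card_ffun card_ord; congr muln.
  rewrite -cardsT -card_perm; apply: eq_card => s.
  by apply/fintype.subsetP => x _; rewrite inE.
apply/subset_leq_card/fintype.subsetP => _ /imsetP[[s g] _ ->]; rewrite inE.
apply/injectiveP => u v; rewrite /= !ffunE !enum_rankK /=; exact: perm_inj.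
Qed.

Lemma rb_blowup (H : sgraph) (r q : nat) :
  (0 < r)%N -> ('C(#|{: H}|, 2) <= r)%N ->
  ((#|{: H}|)`! * q ^ #|{: H}| <= rb r H (#|{: H}| * q) * #|Aut_graph H|)%N.
Proof.
move=> r_gt0 leCr; have [k inj_k] := pair_coloring_exists r_gt0 leCr.
have -> : (#|{: H}| * q)%N = #|{: H * 'I_q}| by rewrite card_prod card_ord.
apply: leq_trans (card_transversals H q) _.
pose h (x : 'I_#|{: H * 'I_q}|) : H := (enum_val x).1.
pose P (c : edge_coloring r #|{: H * 'I_q}|) :=
  [set S : {set 'I__} * {set Kedge _} | is_copy H S && rainbow c S]%SET.
have : (#|transversals h| <= #|P (blowup_coloring k h)| * #|Aut_graph H|)%N.
  apply: card_embeddings_le => f; rewrite inE => /injectiveP inj_hf.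
    exact: inj_compr inj_hf.
  rewrite inE copy_of_is_copy /=; last exact: inj_compr inj_hf.
  exact: transversal_rainbow.
move/leq_trans; apply; rewrite leq_mul2r; apply/orP; right.
exact: (leq_bigmax (F := fun c => #|P c|)).
Qed.

(** * The limiting density of rainbow copies *)

Lemma ffact_le_exp (n k : nat) : (n ^_ k <= n ^ k)%N.
Proof.
rewrite ffact_prod -[X in (n ^ X)%N](card_ord k) -prod_nat_const.
by apply: leq_prod => i _; apply: leq_subr.
Qed.

Lemma rbC_n_blowup (R : realType) (H : sgraph) (r q : nat) :
  (0 < #|{: H}|)%N -> ('C(#|{: H}|, 2) <= r)%N -> (0 < r)%N -> (0 < q)%N ->
  (#|{: H}|)`!%:R / #|{: H}|%:R ^+ #|{: H}| <= rbC_n R r H (#|{: H}| * q).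
Proof.
rewrite /rbC_n => m_gt0 leCr r_gt0 q_gt0; have := rb_blowup q r_gt0 leCr.
set m := #|{: H}| in m_gt0 leCr *; set a := #|Aut_graph H|; set b := rb _ _ _ => le_b.
have aut_gt0 : (0 < a)%N.
  rewrite card_gt0; apply/set0Pn; exists 1%g; rewrite inE.
  by apply/forallP => x; apply/forallP => y; rewrite !perm1.
have C_gt0 : (0 < 'C(m * q, m) * m`!)%N.
  by rewrite bin_ffact ffact_gt0 leq_pmulr.
rewrite mulrA -natrM invf_div mulrA -natrM -natrX.
rewrite ler_pdivrMr ?ltr0n ?expn_gt0 ?m_gt0 // mulrAC ler_pdivlMr ?ltr0n //.
rewrite -!natrM ler_nat bin_ffact.
apply: leq_trans (leq_mul (leqnn _) (ffact_le_exp _ _)) _.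
by rewrite expnMn mulnCA mulnC leq_mul2r le_b orbT.
Qed.

(** The blow-up with equal classes exists only when [m] divides the number of
vertices; a bound along these multiples is enough for the limit. *)
Lemma limn_ge_multiples (R : realType) (u : nat -> R) (m : nat) (c : R) :
  (0 < m)%N -> cvgn u -> (forall q, (0 < q)%N -> c <= u (m * q)%N) ->
  c <= limn u.
Proof.
move=> m_gt0 cu ge_c.
have mulm_cvg : ((muln m q @[q --> \oo]) --> \oo)%classic.
  apply/cvgnyPge => A; near=> q; apply: (@leq_trans q); last exact: leq_pmull.
  by near: q; apply: nbhs_infty_ge.
have cum := cvg_comp _ _ mulm_cvg cu.
rewrite -(cvg_lim (@Rhausdorff R) cum); apply: limr_ge.
  by apply/cvg_ex; exists (limn u).
near=> q; apply: ge_c; near: q; exact: nbhs_infty_gt.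
Unshelve. all: by end_near. Qed.

(** * Comparison of the two constants *)

(** By induction, since passing from [k] to [k + 1] multiplies
[k ^ k / k`!] by [(1 + 1 / k) ^ k], which is at most [exp 1]. *)
Lemma fact_ge_expR (R : realType) (k : nat) :
  k.+1%:R ^+ k.+1 <= k.+1`!%:R * expR k%:R :> R.
Proof.
elim: k => [|k IHk]; first by rewrite expr1 expR0 mulr1 lexx.
set n := k.+1 in IHk *; have n_gt0 : 0 < n%:R :> R by rewrite ltr0n.
have step : n.+1%:R ^+ n <= n%:R ^+ n * expR 1 :> R.
  have -> : n.+1%:R = n%:R * (1 + n%:R^-1) :> R.
    by rewrite mulrDr mulr1 divff ?gt_eqF // natr1.
  rewrite exprMn ler_pM2l ?exprn_gt0 //.
  have -> : expR 1 = expR n%:R^-1 ^+ n :> R by rewrite -expRM_natl divff ?gt_eqF.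
  by apply: lerXn2r (expR_ge1Dx _); rewrite nnegrE ?expR_ge0.
rewrite exprS factS natrM -mulrA ler_pM2l ?ltr0n //.
have -> : expR n%:R = expR k%:R * expR 1 :> R by rewrite -expRD natr1.
apply: le_trans step _; rewrite mulrA.
by rewrite ler_pM2r ?expR_gt0.
Qed.

(** For [e <= r] the ratio is the product of the nonnegative [1 - i / r] for
[i < e]; each factor is at most [exp (- i / r)], and the [i < e] sum to
['C(e, 2)].  For [e > r] the ratio vanishes. *)
Lemma ffact_le_expR (R : realType) (r e : nat) : (0 < r)%N ->
  (r ^_ e)%:R / r%:R ^+ e <= expR (- ('C(e, 2)%:R / r%:R)) :> R.
Proof.
move=> r_gt0; have r0 : 0 < r%:R :> R by rewrite ltr0n.
elim: e => [|e IHe]; first by rewrite ffactn0 expr0 divr1 mul0r oppr0 expR0.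
have [le_er | lt_re] := leqP e r; last first.
  by rewrite ffact_small ?mul0r ?expR_ge0 // ltnS ltnW.
rewrite ffactnSr natrM exprSr invfM mulrACA.
have -> : - ('C(e.+1, 2)%:R / r%:R) = - ('C(e, 2)%:R / r%:R) + - (e%:R / r%:R) :> R.
  by rewrite binS bin1 natrD mulrDl opprD.
rewrite expRD ler_pM ?divr_ge0 ?ler0n ?exprn_ge0 //.
apply: le_trans (expR_ge1Dx _).
by rewrite natrB // mulrBl divff ?gt_eqF.
Qed.

(** The square of the hypothesis reads [e ^ 2 > m ^ 2 * (m - 1)].  Since
[2 * e <= m * (m - 1)], subtracting [e] leaves more than
[m ^ 2 * (m - 1) - m * (m - 1) = m * (m - 1) ^ 2]. *)
Lemma edge_bound_exponent (R : realType) (m e : nat) :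
  (1 < m)%N -> (e <= 'C(m, 2))%N ->
  m%:R * Num.sqrt (m%:R - 1) < e%:R :> R ->
  m%:R - 1 < 'C(e, 2)%:R / 'C(m, 2)%:R :> R.
Proof.
move=> m_gt1 le_eC ltme.
have twoC k : 'C(k, 2)%:R * 2 = k%:R * (k%:R - 1) :> R.
  case: k => [|k]; first by rewrite bin0n mul0r mul0r.
  by rewrite -natrM mulnC -mul_bin_diag bin1 natrM -[in RHS]natr1 addrK natr1.
have m1 : 0 <= m%:R - 1 :> R by rewrite subr_ge0 ler1n ltnW.
have sqr_e : m%:R ^+ 2 * (m%:R - 1) < e%:R ^+ 2 :> R.
  rewrite -[X in _ * X]sqr_sqrtr // -exprMn.
  by rewrite ltrXn2r ?nnegrE ?mulr_ge0 ?ler0n ?sqrtr_ge0.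
have leC : e%:R <= 'C(m, 2)%:R :> R by rewrite ler_nat.
rewrite ltr_pdivlMr ?ltr0n ?bin_gt0 //.
by have := twoC m; have := twoC e; nra.
Qed.

Lemma ffact_ratio_lt (R : realType) (m e : nat) :
  (1 < m)%N -> (e <= 'C(m, 2))%N ->
  m%:R * Num.sqrt (m%:R - 1) < e%:R :> R ->
  ('C(m, 2) ^_ e)%:R / 'C(m, 2)%:R ^+ e < m`!%:R / m%:R ^+ m :> R.
Proof.
move=> m_gt1 le_eC ltme; have C_gt0 : (0 < 'C(m, 2))%N by rewrite bin_gt0.
apply: le_lt_trans (ffact_le_expR R e C_gt0) _.
have lt_exp := edge_bound_exponent m_gt1 le_eC ltme.
apply: (@lt_le_trans _ _ (expR (- (m%:R - 1)))); first by rewrite ltr_expR ltrN2.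
case: m m_gt1 {le_eC ltme C_gt0 lt_exp} => // k _; rewrite -natr1 addrK natr1.
rewrite ler_pdivlMr ?exprn_gt0 ?ltr0n // expRN mulrC.
by rewrite ler_pdivrMr ?expR_gt0 // fact_ge_expR.
Qed.

Theorem corollary4p6 (R : realType) (H : sgraph) (m e : nat)
    (Hm : #|{: H}| = m) (He : #|edges H| = e)
    (He_gt : m%:R * Num.sqrt (m%:R - 1) < e%:R :> R)
    (Hm6 : (6 <= m)%N) :
  ~ anti_common R 'C(m, 2) H.
Proof.
move=> [_]; rewrite -natrM bin_ffact He => rbCE.
have m_gt1 : (1 < m)%N by apply: leq_trans Hm6.
have le_eC : (e <= 'C(m, 2))%N by rewrite -He -Hm card_edges.
have C_gt0 : (0 < 'C(m, 2))%N by rewrite bin_gt0.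
(* A divergent sequence has limit 0 by convention, whereas the ratio is
   positive because [e <= 'C(m, 2)]. *)
have [cvg_rbC | /dvgP lim0] := pselect (cvgn (rbC_n R 'C(m, 2) H)); last first.
  have : 0 < ('C(m, 2) ^_ e)%:R / 'C(m, 2)%:R ^+ e :> R.
    by rewrite divr_gt0 ?exprn_gt0 ?ltr0n ?ffact_gt0.
  by rewrite -rbCE /rbC lim0 ltxx.
have := ffact_ratio_lt m_gt1 le_eC He_gt.
rewrite -rbCE ltNge => /negP; apply; rewrite -Hm.
apply: (limn_ge_multiples (m := #|{: H}|)); rewrite ?Hm ?(ltnW m_gt1) //.
by move=> q q_gt0; rewrite -Hm rbC_n_blowup // Hm // ltnW.
Qed.
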